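(* Let $A$ be a commutative ring, $\mathfrak{a}$ an ideal of $A$, and $M$ an $A$-module with $\mathfrak{a}$-adic completion $\widehat{M}$. The following conditions are equivalent: (i) The $A$-module $\widehat{M}$ is $\mathfrak{a}$-adically complete. (ii) For every $i \geq 0$ the homomorphism $\tau_{M,i} : A_i \otimes_A M \to A_i \otimes_A \widehat{M}$ is surjective. (iii) For every $i \geq 0$ there is equality $\operatorname{Ker}(\pi_{M,i}) = \mathfrak{a}^{i+1}\widehat{M}$.
   Context: For $i \geq 0$ write $A_i := A/\mathfrak{a}^{i+1}$. For an $A$-module $M$, its $\mathfrak{a}$-adic completion is the $A$-module $\widehat{M} := \varprojlim_i (A_i \otimes_A M)$, with canonical homomorphism $\tau_M : M \to \widehat{M}$. The module $M$ is called $\mathfrak{a}$-adically complete if $\tau_M$ is bijective (in particular this applies to the $A$-module $\widehat{M}$, whose own completion is formed with respect to the submodules $\mathfrak{a}^{i+1}\widehat{M}$). The homomorphism $\tau_{M,i} := \mathrm{id}_{A_i} \otimes \tau_M : A_i \otimes_A M \to A_i \otimes_A \widehat{M}$ is the one induced by $\tau_M$, and $\pi_{M,i} : \widehat{M} \to A_i \otimes_A M$ is the canonical (surjective) projection from the inverse limit. *)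

(* Defs.v *)
From HB Require Import structures.
From mathcomp Require Import all_boot all_algebra.
From mathcomp Require Import generic_quotient ring_quotient.
From mathcomp Require Import boolp classical_sets.
From mathcomp.multinomials Require Import freeg.

Set Implicit Arguments.
Unset Strict Implicit.
Unset Printing Implicit Defensive.

Import GRing.Theory.
Local Open Scope ring_scope.
Local Open Scope quotient_scope.
Local Open Scope classical_set_scope.

Section Span.
Variables (R : pzRingType) (V : lmodType R).

Definition lspan (S : set V) : {pred V} :=
  fun x => `[< forall U : {pred V},
    GRing.submod_closed U -> (forall s, S s -> s \in U) -> x \in U >].

Lemma lspanP (S : set V) x :
  reflect (forall U : {pred V},
    GRing.submod_closed U -> (forall s, S s -> s \in U) -> x \in U)
    (x \in lspan S).
Proof. exact: asboolP. Qed.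

Lemma mem_lspan (S : set V) x : S x -> x \in lspan S.
Proof. by move=> Sx; apply/lspanP => U _; apply. Qed.

Lemma lspan_submod_closed S : GRing.submod_closed (lspan S).
Proof.
split; first by apply/lspanP => U [].
move=> r u v /lspanP Su /lspanP Sv; apply/lspanP => U modU sSU.
by case: (modU) => _; apply; [apply: Su | apply: Sv].
Qed.

HB.instance Definition _ S :=
  GRing.isSubmodClosed.Build R V (lspan S) (lspan_submod_closed S).

End Span.

Section QuotientModule.
Variables (R : pzRingType) (V : lmodType R).

(* In the library, submodClosed does not inherit from zmodClosed, which the
   quotient of a zmodType requires. *)
Definition submod_pred (U : submodClosed V) : {pred V} := U.

Lemma submod_pred_closed U : GRing.submod_closed (submod_pred U).
Proof. exact: GRing.submodClosedP. Qed.

HB.instance Definition _ U :=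
  GRing.isSubmodClosed.Build R V (submod_pred U) (submod_pred_closed U).

Variable U : submodClosed V.

Definition quotmod : Type := Quotient.quot (submod_pred U).

HB.instance Definition _ := GRing.Zmodule.on quotmod.

Definition quotmod_pi (x : V) : quotmod := \pi_(Quotient.quot (submod_pred U)) x.

Lemma quotmod_piP x y : reflect (quotmod_pi x = quotmod_pi y) (x - y \in U).
Proof. by rewrite (Quotient.idealrBE (submod_pred U)); apply: eqP. Qed.

Lemma quotmod_piB : {morph quotmod_pi : x y / x - y}.
Proof. by move=> x y; rewrite /quotmod_pi raddfB. Qed.

Lemma quotmod_piD : {morph quotmod_pi : x y / x + y}.
Proof. by move=> x y; rewrite /quotmod_pi raddfD. Qed.

Definition quotmod_repr (x : quotmod) : V :=
  repr (x : Quotient.quot (submod_pred U)).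

Lemma quotmod_reprK : cancel quotmod_repr quotmod_pi.
Proof. exact: reprK. Qed.

Definition quotmod_scale (r : R) (x : quotmod) : quotmod :=
  quotmod_pi (r *: quotmod_repr x).

Lemma quotmod_scaleE r x : quotmod_scale r (quotmod_pi x) = quotmod_pi (r *: x).
Proof.
apply/quotmod_piP; rewrite -scalerBr.
by apply/rpredZ/quotmod_piP; rewrite quotmod_reprK.
Qed.

Fact quotmod_scaleA r s x :
  quotmod_scale r (quotmod_scale s x) = quotmod_scale (r * s) x.
Proof. by rewrite -[x]quotmod_reprK !quotmod_scaleE scalerA. Qed.

Fact quotmod_scale1 : left_id 1 quotmod_scale.
Proof. by move=> x; rewrite -[x]quotmod_reprK !quotmod_scaleE scale1r. Qed.

Fact quotmod_scaleDr : right_distributive quotmod_scale +%R.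
Proof.
move=> r x y; rewrite -[x]quotmod_reprK -[y]quotmod_reprK.
by rewrite -quotmod_piD !quotmod_scaleE -quotmod_piD scalerDr.
Qed.

Fact quotmod_scaleDl x : {morph quotmod_scale^~ x : r s / r + s}.
Proof.
move=> r s; rewrite -[x]quotmod_reprK.
by rewrite !quotmod_scaleE -quotmod_piD scalerDl.
Qed.

HB.instance Definition _ := GRing.Zmodule_isLmodule.Build R quotmod
  quotmod_scaleA quotmod_scale1 quotmod_scaleDr quotmod_scaleDl.

Fact quotmod_pi_linear : linear quotmod_pi.
Proof.
by move=> r x y; rewrite quotmod_piD; congr (_ + _); rewrite -quotmod_scaleE.
Qed.

HB.instance Definition _ :=
  GRing.isLinear.Build R V quotmod _ quotmod_pi quotmod_pi_linear.

End QuotientModule.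

Section QuotientProjection.
Variables (R : pzRingType) (V : lmodType R) (U W : submodClosed V).

(* The inclusion proof is an argument so that linearity can be inferred. *)
Definition quotmod_proj of {subset U <= W} : quotmod U -> quotmod W :=
  fun x => quotmod_pi W (quotmod_repr x).

Lemma quotmod_projE (sUW : {subset U <= W}) x :
  quotmod_proj sUW (quotmod_pi U x) = quotmod_pi W x.
Proof. by apply/quotmod_piP/sUW/quotmod_piP; rewrite quotmod_reprK. Qed.

Fact quotmod_proj_linear (sUW : {subset U <= W}) : linear (quotmod_proj sUW).
Proof.
move=> r x y; rewrite -[x]quotmod_reprK -[y]quotmod_reprK.
by rewrite -linearP !quotmod_projE linearP.
Qed.

HB.instance Definition _ (sUW : {subset U <= W}) :=
  GRing.isLinear.Build R (quotmod U) (quotmod W) _ (quotmod_proj sUW)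
    (quotmod_proj_linear sUW).

End QuotientProjection.

Section Tensor.
Variables (A : comPzRingType) (M N : lmodType A).

Local Notation free := {freeg (M * N)%type}.

Definition fgen (x : M) (y : N) : free := [freeg [:: (1, (x, y))]].

Inductive tensor_rel : set free :=
| TensorDl x x' y : tensor_rel (fgen (x + x') y - (fgen x y + fgen x' y))
| TensorDr x y y' : tensor_rel (fgen x (y + y') - (fgen x y + fgen x y'))
| TensorZ (r : A) x y : tensor_rel (fgen (r *: x) y - fgen x (r *: y)).

(* The free abelian group is a module over int, so this span is the subgroup
   generated by the relations. *)
Definition tensor_ker : {pred free} := lspan tensor_rel.

HB.instance Definition _ := GRing.ZmodClosed.on tensor_ker.

Definition tensor : Type := Quotient.quot tensor_ker.

HB.instance Definition _ := GRing.Zmodule.on tensor.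

Definition tensor_pi (u : free) : tensor := \pi_(Quotient.quot tensor_ker) u.

Definition tensor_repr (t : tensor) : free :=
  repr (t : Quotient.quot tensor_ker).

Lemma tensor_reprK : cancel tensor_repr tensor_pi.
Proof. exact: reprK. Qed.

HB.instance Definition _ := GRing.Additive.copy tensor_pi
  \pi_(Quotient.quot tensor_ker).

Lemma tensor_piP u v : reflect (tensor_pi u = tensor_pi v) (u - v \in tensor_ker).
Proof. by rewrite (Quotient.idealrBE tensor_ker); apply: eqP. Qed.

Definition tens (x : M) (y : N) : tensor := tensor_pi (fgen x y).

Lemma tensDl x x' y : tens (x + x') y = tens x y + tens x' y.
Proof. by rewrite -(raddfD tensor_pi); apply/tensor_piP/mem_lspan; constructor. Qed.

Lemma tensDr x y y' : tens x (y + y') = tens x y + tens x y'.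
Proof. by rewrite -(raddfD tensor_pi); apply/tensor_piP/mem_lspan; constructor. Qed.

Lemma tensZ r x y : tens (r *: x) y = tens x (r *: y).
Proof. by apply/tensor_piP/mem_lspan; constructor. Qed.

Lemma tensor_ind (K : tensor -> Prop) :
    (forall x y, K (tens x y)) -> (forall t, K t -> K (- t)) ->
    (forall s t, K s -> K t -> K (s + t)) -> K 0 ->
  forall t, K t.
Proof.
move=> Kt KN KD K0 t; rewrite -[t]tensor_reprK.
rewrite -(freeg_sumE (tensor_repr t)).
elim: (dom _) => [|[x y] s IHs].
  by rewrite big_nil raddf0.
rewrite big_cons raddfD; apply: (KD _ _ _ IHs) => {IHs}.
have Kn (n : nat) : K (tensor_pi [freeg [:: (n%:Z, (x, y))]]).
  elim: n => [|n IHn].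
    by rewrite freegU0 raddf0.
  by rewrite -addn1 PoszD -freegUD raddfD; apply: KD => //; apply: Kt.
case: (coeff _ _) => n; first exact: Kn.
by rewrite NegzE -freegUN raddfN; apply/KN/Kn.
Qed.

Definition balanced (P : zmodType) (h : M -> N -> P) :=
  [/\ forall x x' y, h (x + x') y = h x y + h x' y,
      forall x y y', h x (y + y') = h x y + h x y'
    & forall r x y, h (r *: x) y = h x (r *: y)].

Section Lift.
Variables (P : zmodType) (h : M -> N -> P).

Definition free_lift (u : free) : P :=
  fglift (fun p : M * N => h p.1 p.2 : zmodule P) u.

Fact free_lift_zmod_morphism : zmod_morphism free_lift.
Proof. exact: (@lift_is_additive int _ (zmodule P)). Qed.

HB.instance Definition _ :=
  GRing.isZmodMorphism.Build free P free_lift free_lift_zmod_morphism.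

Lemma free_liftE x y : free_lift (fgen x y) = h x y.
Proof. by rewrite /free_lift liftU scale1r. Qed.

(* The homomorphism of abelian groups sending tens x y to h x y. *)
Definition tensor_lift of balanced h : tensor -> P :=
  fun t => free_lift (tensor_repr t).

Hypothesis hB : balanced h.

Lemma free_lift_ker u : u \in tensor_ker -> free_lift u = 0.
Proof.
move=> /lspanP /(_ (fun u => free_lift u == 0)) ku; apply/eqP/ku.
  split=> [|n v w]; first by rewrite unfold_in raddf0.
  rewrite !unfold_in => /eqP v0 /eqP w0.
  by rewrite raddfD -[n]intz scaler_int raddfMz /= v0 w0 mul0rz addr0.
case: hB => hDl hDr hZ.
by move=> _ []*; rewrite unfold_in raddfB /= subr_eq0 ?raddfD /= !free_liftE ?hDl ?hDr ?hZ.
Qed.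

Lemma tensor_lift_pi u : tensor_lift hB (tensor_pi u) = free_lift u.
Proof.
apply/eqP; rewrite -subr_eq0 -raddfB; apply/eqP/free_lift_ker.
by apply/tensor_piP; rewrite tensor_reprK.
Qed.

Lemma tensor_liftE x y : tensor_lift hB (tens x y) = h x y.
Proof. by rewrite tensor_lift_pi free_liftE. Qed.

Fact tensor_lift_zmod_morphism : zmod_morphism (tensor_lift hB).
Proof.
move=> s t; rewrite -[s]tensor_reprK -[t]tensor_reprK.
by rewrite -(raddfB tensor_pi) !tensor_lift_pi raddfB.
Qed.

HB.instance Definition _ := GRing.isZmodMorphism.Build tensor P
  (tensor_lift hB) tensor_lift_zmod_morphism.

End Lift.

Lemma eq_tensor_morph (P : zmodType) (f g : {additive tensor -> P}) :
  (forall x y, f (tens x y) = g (tens x y)) -> f =1 g.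
Proof.
move=> fg; elim/tensor_ind => [//|t|s t|]; last by rewrite !raddf0.
  by rewrite !raddfN => ->.
by rewrite !raddfD => -> ->.
Qed.

Fact tensor_scale_balanced (r : A) : balanced (fun x y => tens (r *: x) y).
Proof.
split=> [x x' y|x y y'|s x y]; first by rewrite scalerDr tensDl.
  exact: tensDr.
by rewrite -tensZ !scalerA mulrC.
Qed.

Definition tensor_scale (r : A) : tensor -> tensor :=
  tensor_lift (tensor_scale_balanced r).

Lemma tensor_scaleE r x y : tensor_scale r (tens x y) = tens (r *: x) y.
Proof. exact: tensor_liftE. Qed.

HB.instance Definition _ r := GRing.Additive.copy (tensor_scale r)
  (tensor_lift (tensor_scale_balanced r)).

Fact tensor_scaleA r s t :
  tensor_scale r (tensor_scale s t) = tensor_scale (r * s) t.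
Proof.
apply: (eq_tensor_morph (f := tensor_scale r \o tensor_scale s)) => x y /=.
by rewrite !tensor_scaleE scalerA.
Qed.

Fact tensor_scale1 : left_id 1 tensor_scale.
Proof.
apply: (eq_tensor_morph (g := idfun)) => x y /=.
by rewrite tensor_scaleE scale1r.
Qed.

Fact tensor_scaleDr : right_distributive tensor_scale +%R.
Proof. by move=> r s t; rewrite raddfD. Qed.

Fact tensor_scaleDl t : {morph tensor_scale^~ t : r s / r + s}.
Proof.
move=> r s.
apply: (eq_tensor_morph (g := tensor_scale r \+ tensor_scale s)) => x y /=.
by rewrite !tensor_scaleE scalerDl tensDl.
Qed.

HB.instance Definition _ := GRing.Zmodule_isLmodule.Build A tensor
  tensor_scaleA tensor_scale1 tensor_scaleDr tensor_scaleDl.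

Lemma scale_tensl r x y : r *: tens x y = tens (r *: x) y.
Proof. exact: tensor_scaleE. Qed.

Lemma scale_tensr r x y : r *: tens x y = tens x (r *: y).
Proof. by rewrite scale_tensl tensZ. Qed.

End Tensor.

Section TensorMap.
Variables (A : comPzRingType) (M M' N N' : lmodType A).
Variables (f : {linear M -> M'}) (g : {linear N -> N'}).

Fact tensor_map_balanced : balanced (fun x y => tens (f x) (g y)).
Proof.
split=> [x x' y|x y y'|r x y]; first by rewrite raddfD tensDl.
  by rewrite raddfD tensDr.
by rewrite !linearZ tensZ.
Qed.

Definition tensor_map : tensor M N -> tensor M' N' :=
  tensor_lift tensor_map_balanced.

Lemma tensor_mapE x y : tensor_map (tens x y) = tens (f x) (g y).
Proof. exact: tensor_liftE. Qed.

HB.instance Definition _ := GRing.Additive.copy tensor_map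
  (tensor_lift tensor_map_balanced).

Fact tensor_map_scalable : scalable tensor_map.
Proof.
move=> r; apply: (eq_tensor_morph (f := tensor_map \o ( *:%R r))
  (g := ( *:%R r) \o tensor_map)) => x y /=.
by rewrite scale_tensl !tensor_mapE linearZ -scale_tensl.
Qed.

HB.instance Definition _ := GRing.isScalable.Build A (tensor M N)
  (tensor M' N') _ tensor_map tensor_map_scalable.

End TensorMap.

Section InverseLimit.
Variables (R : pzRingType) (T : nat -> lmodType R).
Variable p : forall i, {linear T i.+1 -> T i}.

Record invlim := InvLim {
  invlim_fun :> forall i, T i;
  invlim_compat : forall i, p i (invlim_fun i.+1) = invlim_fun i
}.

HB.instance Definition _ := gen_eqMixin invlim.
HB.instance Definition _ := gen_choiceMixin invlim.

Lemma invlimP (x y : invlim) : (forall i, x i = y i) -> x = y.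
Proof.
case: x y => [x xP] [y yP] /= xy.
have eq_xy : x = y by apply: functional_extensionality_dep.
by case: _ / eq_xy yP => yP; rewrite (Prop_irrelevance xP yP).
Qed.

Fact invlim0_compat i : p i 0 = 0. Proof. exact: linear0. Qed.

Fact invlimN_compat (x : invlim) i : p i (- x i.+1) = - x i.
Proof. by rewrite linearN invlim_compat. Qed.

Fact invlimD_compat (x y : invlim) i : p i (x i.+1 + y i.+1) = x i + y i.
Proof. by rewrite linearD !invlim_compat. Qed.

Fact invlimZ_compat r (x : invlim) i : p i (r *: x i.+1) = r *: x i.
Proof. by rewrite linearZ invlim_compat. Qed.

Definition invlim0 := InvLim invlim0_compat.
Definition invlimN x := InvLim (invlimN_compat x).
Definition invlimD x y := InvLim (invlimD_compat x y).
Definition invlimZ r x := InvLim (invlimZ_compat r x).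

Fact invlimDA : associative invlimD.
Proof. by move=> x y z; apply: invlimP => i /=; rewrite addrA. Qed.

Fact invlimDC : commutative invlimD.
Proof. by move=> x y; apply: invlimP => i /=; rewrite addrC. Qed.

Fact invlim0D : left_id invlim0 invlimD.
Proof. by move=> x; apply: invlimP => i /=; rewrite add0r. Qed.

Fact invlimND : left_inverse invlim0 invlimN invlimD.
Proof. by move=> x; apply: invlimP => i /=; rewrite addNr. Qed.

HB.instance Definition _ :=
  GRing.isZmodule.Build invlim invlimDA invlimDC invlim0D invlimND.

Fact invlimZA r s x : invlimZ r (invlimZ s x) = invlimZ (r * s) x.
Proof. by apply: invlimP => i /=; rewrite scalerA. Qed.

Fact invlim1Z : left_id 1 invlimZ.
Proof. by move=> x; apply: invlimP => i /=; rewrite scale1r. Qed.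

Fact invlimZDr : right_distributive invlimZ +%R.
Proof. by move=> r x y; apply: invlimP => i /=; rewrite scalerDr. Qed.

Fact invlimZDl x : {morph invlimZ^~ x : r s / r + s}.
Proof. by move=> r s; apply: invlimP => i /=; rewrite scalerDl. Qed.

HB.instance Definition _ := GRing.Zmodule_isLmodule.Build R invlim
  invlimZA invlim1Z invlimZDr invlimZDl.

Definition invlim_proj i (x : invlim) : T i := x i.

Fact invlim_proj_linear i : linear (invlim_proj i).
Proof. by []. Qed.

HB.instance Definition _ i :=
  GRing.isLinear.Build R invlim (T i) _ (invlim_proj i) (invlim_proj_linear i).

End InverseLimit.

Section Completion.
(* The ideals of A are the submodules of the regular module A^o. *)
Variables (A : comPzRingType) (a : submodClosed A^o).

(* The ideal generated by the products of n elements of a. *)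
Definition ideal_pow (n : nat) : {pred A^o} :=
  @lspan A A^o [set r | exists2 s : 'I_n -> A^o,
                  (forall j, s j \in a) & r = \prod_(j < n) (s j : A)].

HB.instance Definition _ n := GRing.SubmodClosed.on (ideal_pow n).

Lemma ideal_powS n : {subset ideal_pow n.+1 <= ideal_pow n}.
Proof.
move=> r /lspanP; apply; first exact: lspan_submod_closed.
move=> _ [s sa ->]; rewrite big_ord_recl.
apply: (@rpredZ _ A^o (ideal_pow n)); apply: mem_lspan.
by exists (fun j => s (fintype.lift ord0 j)).
Qed.

(* Only the A-module structure of A / a ^ (i + 1) is needed. *)
Definition quot_pow (i : nat) : lmodType A := quotmod (ideal_pow i.+1).

Definition quot_pow1 (i : nat) : quot_pow i := quotmod_pi (ideal_pow i.+1) 1.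

Definition quot_pow_step (i : nat) : {linear quot_pow i.+1 -> quot_pow i} :=
  quotmod_proj (@ideal_powS i.+1).

Lemma quot_pow_step1 i : quot_pow_step i (quot_pow1 i.+1) = quot_pow1 i.
Proof. exact: quotmod_projE. Qed.

Section Module.
Variable M : lmodType A.

Definition pow_smul (n : nat) : {pred M} :=
  lspan [set x | exists2 r : A^o, r \in ideal_pow n & exists y : M, x = (r : A) *: y].

Definition completion_step (i : nat) :
    {linear tensor (quot_pow i.+1) M -> tensor (quot_pow i) M} :=
  tensor_map (quot_pow_step i) idfun.

Definition completion : lmodType A :=
  @invlim A (fun i => tensor (quot_pow i) M) completion_step.

Definition completion_pi (i : nat) :
    {linear completion -> tensor (quot_pow i) M} :=
  @invlim_proj A (fun i => tensor (quot_pow i) M) completion_step i.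

Fact completion_tau_compat (x : M) i :
  completion_step i (tens (quot_pow1 i.+1) x) = tens (quot_pow1 i) x.
Proof. by rewrite [LHS]tensor_mapE quot_pow_step1. Qed.

Definition completion_tau (x : M) : completion :=
  @InvLim A (fun i => tensor (quot_pow i) M) completion_step
    (fun i => tens (quot_pow1 i) x) (completion_tau_compat x).

Fact completion_tau_linear : linear completion_tau.
Proof. by move=> r x y; apply: invlimP => i /=; rewrite tensDr -scale_tensr. Qed.

HB.instance Definition _ := GRing.isLinear.Build A M completion _
  completion_tau completion_tau_linear.

Definition adically_complete : Prop := bijective completion_tau.

Definition tensor_tau (i : nat) :
    {linear tensor (quot_pow i) M -> tensor (quot_pow i) completion} :=
  tensor_map idfun completion_tau.

End Module.
End Completion.

Arguments pow_smul {A} a M n.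
Arguments adically_complete {A} a M.

(* Main.v *)
Require Import Defs.
From HB Require Import structures.
From mathcomp Require Import all_boot all_algebra.
From mathcomp Require Import boolp.

Set Implicit Arguments.
Unset Strict Implicit.
Unset Printing Implicit Defensive.

Import GRing.Theory.
Local Open Scope ring_scope.

(** Write [N] for the completion of [M].  Since [A_i] is generated by the class
    of [1], every element of [A_i ⊗ M] has the form [1 ⊗ x], and [1 ⊗ x = 0]
    exactly when [x] lies in [a^(i+1) M].  So [A_i ⊗ M] is [M / a^(i+1) M]
    ([tens1_surj], [tens1_eq0]), and everything reduces to congruences.  As
    [pi_i] kills [a^(i+1) N] and [pi_i (tau m) = 1 ⊗ m], a congruence of
    [w : N] and [tau m] modulo [a^(i+1) N] determines [pi_i w]
    ([completion_pi_tens1]).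

    The equivalence of (ii) and (iii) compares [x : N] with [tau m], where
    [pi_i x = 1 ⊗ m]: the difference is in the kernel of [pi_i], and surjectivity
    of [tau_i] amounts to its being in [a^(i+1) N] ([tensor_tau_surj_ker]).

    Under (iii), the [a]-adic topology of [N] is the one given by the kernels of
    the projections [pi_i], and an inverse limit is separated and complete for
    the latter, whence (i) ([completion_complete]).

    The direction from (i) to (ii) is the one with an idea.  There are two maps
    from [N] to its completion: [tau_N], and the completion of [tau_M], which
    sends [x] to the family of the [tau_(M,i) (pi_i x)].  If [tau_N] is
    surjective, that family is [tau_N w] for some [w]; applying the projections
    shows that [w] and [x] have the same components, so [w = x].  Hence
    [1 ⊗ x = tau_(M,i) (pi_i x)] ([tens1_completion]), and this is in the image
    of [tau_(M,i)]. *)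

Section TensorLinear.
Variables (A : comPzRingType) (M N : lmodType A) (x : M).

Fact tens_linear : linear (@tens A M N x).
Proof. by move=> r y z; rewrite tensDr -scale_tensr. Qed.

HB.instance Definition _ :=
  GRing.isLinear.Build A N (tensor M N) _ (tens x) tens_linear.

End TensorLinear.

Section TensorQuotient.
Variables (A : comPzRingType) (a : submodClosed A^o) (M : lmodType A).

HB.instance Definition _ n := GRing.SubmodClosed.on (pow_smul a M n).

Lemma scale_quot_pow1 i (r : A) :
  r *: quot_pow1 a i = quotmod_pi (ideal_pow a i.+1) r.
Proof. by rewrite /quot_pow1 -linearZ /= [_ *: _]mulr1. Qed.

Lemma scale_quot_pow1_eq0 i (r : A) :
  r \in ideal_pow a i.+1 -> r *: quot_pow1 a i = 0.
Proof.
move=> rI; rewrite scale_quot_pow1 -(linear0 (quotmod_pi (ideal_pow a i.+1))).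
by apply/quotmod_piP; rewrite subr0.
Qed.

Lemma tens1_surj i (t : tensor (quot_pow a i) M) :
  exists x, t = tens (quot_pow1 a i) x.
Proof.
elim/tensor_ind: t => [u x|_ [x ->]|_ _ [x ->] [y ->]|].
- exists (quotmod_repr u *: x).
  by rewrite -tensZ scale_quot_pow1 quotmod_reprK.
- by exists (- x); rewrite linearN.
- by exists (x + y); rewrite linearD.
- by exists 0; rewrite linear0.
Qed.

(** The action of [A_i] on [M / a^(i+1) M], precomposed with the quotient map of
    [M]; it is the balanced map that detects the elements [1 ⊗ x]. *)
Definition quot_pow_act i (u : quot_pow a i) (x : M) :
    quotmod (pow_smul a M i.+1) :=
  quotmod_pi (pow_smul a M i.+1) ((quotmod_repr u : A) *: x).

Lemma quot_pow_actE i (r : A) (x : M) :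
  quot_pow_act (quotmod_pi (ideal_pow a i.+1) r) x =
  quotmod_pi (pow_smul a M i.+1) (r *: x).
Proof.
apply/quotmod_piP; rewrite -scalerBl; apply: mem_lspan.
exists (quotmod_repr (quotmod_pi (ideal_pow a i.+1) r) - r); last by exists x.
by apply/quotmod_piP; rewrite quotmod_reprK.
Qed.

Lemma quot_pow_act_balanced i : balanced (@quot_pow_act i).
Proof.
split=> [u v x|u x y|r u x].
- rewrite -[u]quotmod_reprK -[v]quotmod_reprK -quotmod_piD !quot_pow_actE.
  by rewrite -quotmod_piD -scalerDl.
- by rewrite /quot_pow_act scalerDr quotmod_piD.
- rewrite -[u]quotmod_reprK -linearZ !quot_pow_actE scalerA.
  by rewrite [in RHS]mulrC.
Qed.

(** The elements of [a^(i+1) M] die because [a^(i+1)] can be moved to the left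
    factor; no others do, as [A_i] acts on [M / a^(i+1) M], so that [1 ⊗ x] is
    sent to the class of [x] by a map on the tensor product. *)
Lemma tens1_eq0 i (x : M) :
  tens (quot_pow1 a i) x = 0 <-> x \in pow_smul a M i.+1.
Proof.
split=> [x0|].
  have := tensor_liftE (quot_pow_act_balanced i) (quot_pow1 a i) x.
  rewrite x0 raddf0 quot_pow_actE scale1r.
  rewrite -(linear0 (quotmod_pi (pow_smul a M i.+1))) => /esym/quotmod_piP.
  by rewrite subr0.
move=> /lspanP /(_ (fun x => tens (quot_pow1 a i) x == 0)) x0; apply/eqP/x0.
  split=> [|r y z]; rewrite !unfold_in.
    by rewrite linear0.
  by move=> /eqP y0 /eqP z0; rewrite linearP /= y0 z0 scaler0 addr0.
move=> _ [r rI [y ->]]; rewrite unfold_in -tensZ scale_quot_pow1_eq0 //.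
by rewrite -(scale0r 0) -scale_tensl scale0r.
Qed.

Lemma tens1_eq i (x y : M) :
  tens (quot_pow1 a i) x = tens (quot_pow1 a i) y <-> x - y \in pow_smul a M i.+1.
Proof.
rewrite -tens1_eq0 linearB /=; split=> [->|/eqP]; first exact: subrr.
by rewrite subr_eq0 => /eqP.
Qed.

End TensorQuotient.

Lemma pow_smul_linear (A : comPzRingType) (a : submodClosed A^o)
    (M N : lmodType A) (f : {linear M -> N}) n x :
  x \in pow_smul a M n -> f x \in pow_smul a N n.
Proof.
move=> /lspanP /(_ (fun x => f x \in pow_smul a N n)); apply.
  split=> [|r y z fy fz]; first by rewrite unfold_in linear0 rpred0.
  by rewrite unfold_in linearP; apply: rpredD fz; apply: rpredZ fy.
move=> _ [r rI [y ->]]; rewrite unfold_in linearZ.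
by apply: mem_lspan; exists r => //; exists (f y).
Qed.

Section CompletionLemmas.
Variables (A : comPzRingType) (a : submodClosed A^o) (M : lmodType A).
Let N : lmodType A := completion a M.

Lemma pow_smul_tensor_eq0 i (t : tensor (quot_pow a i) M) :
  t \in pow_smul a (tensor (quot_pow a i) M) i.+1 -> t = 0.
Proof.
move=> /lspanP /(_ (pred1 0)) t0; apply/eqP/t0.
  split=> [|r u v]; rewrite !inE // => /eqP -> /eqP ->.
  by rewrite scaler0 addr0.
move=> _ [r rI [u ->]]; have [x ->] := tens1_surj u.
rewrite inE scale_tensr; apply/eqP/tens1_eq0/mem_lspan.
by exists r => //; exists x.
Qed.

Lemma completion_pi_eq0 i (x : N) :
  x \in pow_smul a N i.+1 -> completion_pi a M i x = 0.
Proof. by move=> xI; apply/pow_smul_tensor_eq0/pow_smul_linear. Qed.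

Lemma completion_pi_tau i (m : M) :
  completion_pi a M i (completion_tau a m) = tens (quot_pow1 a i) m.
Proof. by []. Qed.

Lemma tensor_tau1 i (m : M) :
  tensor_tau a M i (tens (quot_pow1 a i) m) =
  tens (quot_pow1 a i) (completion_tau a m).
Proof. exact: tensor_mapE. Qed.

Lemma completion_pi_tens1 i (x y : N) :
  tens (quot_pow1 a i) x = tens (quot_pow1 a i) y ->
  completion_pi a M i x = completion_pi a M i y.
Proof.
move=> /tens1_eq /completion_pi_eq0 /eqP.
by rewrite linearB subr_eq0 => /eqP.
Qed.

Lemma completion_step_tau i (t : tensor (quot_pow a i.+1) M) :
  completion_step a N i (tensor_tau a M i.+1 t) =
  tensor_tau a M i (completion_step a M i t).
Proof.
have [m ->] := tens1_surj t.
by rewrite tensor_tau1 !completion_tau_compat tensor_tau1.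
Qed.

(** The family with these components is the image of [x] under the completion of
    the map [tau_M]. *)
Lemma tensor_tau_compat (x : N) i :
  completion_step a N i (tensor_tau a M i.+1 (completion_pi a M i.+1 x)) =
  tensor_tau a M i (completion_pi a M i x).
Proof.
rewrite completion_step_tau.
exact: (congr1 (tensor_tau a M i) (invlim_compat x i)).
Qed.

(** Surjectivity of [tau_N] forces [tau_N] to agree with the completion of
    [tau_M], because both have the same left inverse, namely the map induced by
    the projections [pi_i]. *)
Lemma tens1_completion : adically_complete a N ->
  forall i (x : N),
    tens (quot_pow1 a i) x = tensor_tau a M i (completion_pi a M i x).
Proof.
move=> [g _ tauK] i x.
pose z : completion a N := InvLim (tensor_tau_compat x).
have tau_gz j : tens (quot_pow1 a j) (g z) =
    tensor_tau a M j (completion_pi a M j x).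
  exact: (congr1 (completion_pi a N j) (tauK z)).
suff gz_x : g z = x by rewrite -tau_gz gz_x.
apply: invlimP => j; have [m xm] := tens1_surj (completion_pi a M j x).
have := tau_gz j; rewrite xm tensor_tau1 => /completion_pi_tens1.
by rewrite completion_pi_tau -xm.
Qed.

(** For [pi_i x = 1 ⊗ m], the difference [x - tau m] is in [Ker pi_i], and
    [1 ⊗ x = 1 ⊗ tau m] says that it is in [a^(i+1) N].  Conversely, if
    [1 ⊗ x = 1 ⊗ tau m] for an [x] in [Ker pi_i], then [1 ⊗ m = pi_i x = 0], so
    that [1 ⊗ x], the image of [1 ⊗ m] under [tau_i], is zero. *)
Lemma tensor_tau_surj_ker i :
  (forall y : tensor (quot_pow a i) N, exists x, tensor_tau a M i x = y) <->
  (forall x : N, completion_pi a M i x = 0 <-> x \in pow_smul a N i.+1).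
Proof.
split=> [tau_surj x|kerE y].
  split=> [x0|]; last exact: completion_pi_eq0.
  have [t] := tau_surj (tens (quot_pow1 a i) x); have [m ->] := tens1_surj t.
  rewrite tensor_tau1 => tau_m.
  have := completion_pi_tens1 tau_m; rewrite x0 completion_pi_tau => m0.
  by apply/tens1_eq0; rewrite -tau_m -tensor_tau1 m0 linear0.
have [x ->] := tens1_surj y.
have [m xm] := tens1_surj (completion_pi a M i x).
exists (tens (quot_pow1 a i) m); rewrite tensor_tau1; apply/tens1_eq/kerE.
by rewrite linearB xm completion_pi_tau subrr.
Qed.

(** Under the hypothesis, congruence modulo [a^(i+1) N] is equality of the [i]-th
    components, so a compatible family of classes is given by elements [x i] of
    [N] with [pi_i (x i.+1) = pi_i (x i)]; the diagonal [pi_i (x i)] is then an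
    element of [N] that is congruent to each [x i]. *)
Lemma completion_complete :
    (forall i (x : N), completion_pi a M i x = 0 <-> x \in pow_smul a N i.+1) ->
  adically_complete a N.
Proof.
move=> kerE.
have tens1_pi i (x y : N) : tens (quot_pow1 a i) x = tens (quot_pow1 a i) y <->
    completion_pi a M i x = completion_pi a M i y.
  split=> [|xy]; first exact: completion_pi_tens1.
  by apply/tens1_eq/kerE; rewrite linearB xy subrr.
suff [g tauK] : exists g, cancel g (@completion_tau A a N).
  exists g => // x; apply: invlimP => i; apply/tens1_pi.
  exact: (congr1 (completion_pi a N i) (tauK (completion_tau a x))).
suff tau_surj z : exists x : N, completion_tau a x = z.
  by have [g gP] := choice tau_surj; exists g.
have [x xz] := choice (fun i => tens1_surj (completion_pi a N i z)).
have x_compat i : completion_step a M i (completion_pi a M i.+1 (x i.+1)) =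
    completion_pi a M i (x i).
  apply: etrans (invlim_compat (x i.+1) i) _; apply/tens1_pi.
  by rewrite -xz -completion_tau_compat -xz; apply: (invlim_compat z i).
exists (InvLim x_compat); apply: invlimP => i /=.
by rewrite -[RHS]/(completion_pi a N i z) xz; apply/tens1_pi.
Qed.

End CompletionLemmas.

Theorem theorem1p5 (A : comPzRingType) (a : submodClosed A^o) (M : lmodType A) :
  (adically_complete a (completion a M) <->
     (forall (i : nat) (y : tensor (quot_pow a i) (completion a M)),
        exists x : tensor (quot_pow a i) M, tensor_tau a M i x = y)) /\
  ((forall (i : nat) (y : tensor (quot_pow a i) (completion a M)),
      exists x : tensor (quot_pow a i) M, tensor_tau a M i x = y) <->
     (forall (i : nat) (x : completion a M),
        completion_pi a M i x = 0 <-> x \in pow_smul a (completion a M) i.+1)).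
Proof.
split; last first.
  by split=> H i; apply/tensor_tau_surj_ker/H.
split=> [complN i y|tau_surj].
  have [x ->] := tens1_surj y; exists (completion_pi a M i x).
  exact/esym/tens1_completion.
by apply: completion_complete => i; apply/tensor_tau_surj_ker/tau_surj.
Qed.
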